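(* Let $X$ be a complex infinite-dimensional Banach space with a Schauder basis $(e_n)_{n\ge0}$. Then a typical $T\in(\mathcal{P}_1(X),\mathrm{SOT})$ is not quasinilpotent at any non-zero positive vector of $X$. If moreover $X^*$ is separable, then a typical $T\in(\mathcal{P}_1(X),\mathrm{SOT}^* )$ is not quasinilpotent at any non-zero positive vector of $X$.
   Context: Let $(e_n^* )_{n\ge0}$ be the biorthogonal functionals of the basis. A vector $x\in X$ is positive ($x\ge0$) if $\langle e_n^*,x\rangle\ge 0$ for all $n$. A bounded operator $T$ on $X$ is positive if $Tx\ge0$ for every $x\ge0$. $\mathcal{P}_1(X)$ is the set of bounded positive operators on $X$ with $\|T\|\le1$. $T$ is quasinilpotent at $x$ if $\lim_{n}\|T^nx\|^{1/n}=0$. $\mathrm{SOT}$: $T_i\to T$ iff $\|T_ix-Tx\|\to0$ for every $x\in X$. $\mathrm{SOT}^*$: $T_i\to T$ iff $\|T_ix-Tx\|\to0$ for every $x\in X$ and $\|T_i^*x^*-T^*x^*\|\to0$ for every $x^*\in X^*$. ''A typical $T\in(\mathcal{P}_1(X),\tau)$ has property (P)'' means that the set of $T\in\mathcal{P}_1(X)$ with (P) is comeager, i.e. contains a dense $G_\delta$ subset of $(\mathcal{P}_1(X),\tau)$. *)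

(* Defs.v *)
From HB Require Import structures.
From mathcomp Require Import all_boot all_order all_algebra.
From mathcomp Require Import complex.
From mathcomp Require Import all_classical all_reals all_analysis.
From mathcomp Require Import borel_hierarchy.

Set Implicit Arguments.
Unset Strict Implicit.
Unset Printing Implicit Defensive.

Import Order.TTheory GRing.Theory Num.Theory.
Import numFieldNormedType.Exports.

Local Open Scope classical_set_scope.
Local Open Scope ring_scope.
Local Open Scope complex_scope.

(* Norms of an R[i]-normed module take their values in the nonnegative real
   elements of R[i]; rnorm x is the same number seen in R. *)
Definition rnorm (R : realType) (V : normedModType R[i]) (x : V) : R :=
  complex.Re `|x|.

Section rnorm_theory.
Context {R : realType} {V : normedModType R[i]}.
Implicit Types x y : V.

Lemma rnormE x : (rnorm x)%:C = `|x|.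
Proof. by rewrite /rnorm RRe_real // realE normr_ge0. Qed.

Lemma rnorm_ge0 x : 0 <= rnorm x.
Proof. by rewrite -lecR rnormE normr_ge0. Qed.

Lemma ler_rnormD x y : rnorm (x + y) <= rnorm x + rnorm y.
Proof. by rewrite -lecR rmorphD /= !rnormE ler_normD. Qed.

Lemma rnormZ (a : R[i]) x : rnorm (a *: x) = complex.Re `|a| * rnorm x.
Proof.
have aR : (complex.Re `|a|)%:C = `|a| by rewrite RRe_real // realE normr_ge0.
by apply: complexI; rewrite rmorphM /= !rnormE normrZ aR.
Qed.

End rnorm_theory.

Section bounded_operator_pred.
Context {R : realType} (V W : normedModType R[i]).

Definition bounded_operator_pred : {pred V -> W} :=
  fun f => `[< linear f /\ bounded_near f (nbhs (0 : V)) >].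

Lemma bounded_operator_predP (f : V -> W) :
  f \in bounded_operator_pred <->
  linear f /\ exists k : R, forall x, rnorm (f x) <= k * rnorm x.
Proof.
split.
  move=> /asboolP[lf bf]; split=> //.
  pose g : {linear V -> W} := HB.pack f (GRing.isLinear.Build _ _ _ _ f lf).
  have /linear_boundedP/pinfty_ex_gt0[r r0 fr] : bounded_near g (nbhs 0) by [].
  have rR : (complex.Re r)%:C = r by rewrite RRe_real // realE ltW.
  exists (complex.Re r) => x.
  by rewrite -lecR rmorphM /= !rnormE rR; exact: fr.
move=> [lf [k fk]]; apply/asboolP; split=> //.
apply/ex_bound; exists `|k|%:C; apply/nbhs_norm0P; exists 1 => //= x /= x1.
rewrite -rnormE lecR (le_trans (fk x))// (le_trans (ler_norm _))//.
rewrite normrM ler_piMr// ger0_norm ?rnorm_ge0//.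
by rewrite -lecR rnormE ltW.
Qed.

Lemma bounded_operator_submod_closed : submod_closed bounded_operator_pred.
Proof.
split=> [|a f g /bounded_operator_predP[lf [k fk]]
            /bounded_operator_predP[lg [l gl]]];
  apply/bounded_operator_predP; split.
- by move=> b x y; rewrite -[RHS]/(b *: 0 + 0) scaler0 addr0.
- by exists 0 => x; rewrite mul0r /rnorm normr0.
- move=> b x y; rewrite -[LHS]/(a *: f _ + g _) -[RHS]/(b *: (a *: _ + _) + _).
  by rewrite lf lg !scalerDr !scalerA mulrC addrACA.
- exists (complex.Re `|a| * k + l) => x.
  have a0 : 0 <= complex.Re `|a| by exact: (@rnorm_ge0 _ R[i]^o a).
  rewrite (le_trans (ler_rnormD (a *: f x) _))// rnormZ mulrDl lerD//.
  by rewrite -mulrA ler_wpM2l.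
Qed.

HB.instance Definition _ :=
  GRing.isSubmodClosed.Build R[i] (V -> W) bounded_operator_pred
    bounded_operator_submod_closed.

End bounded_operator_pred.

(* The space B(V, W) of bounded linear maps, normed by the operator norm. *)
Section bounded_operator.
Context {R : realType} (V W : normedModType R[i]).

Record bounded_operator := BoundedOperator {
  bounded_operator_fun :> V -> W ;
  bounded_operatorP :
    bounded_operator_fun \in @bounded_operator_pred R V W }.

HB.instance Definition _ := [isSub for bounded_operator_fun].
HB.instance Definition _ := [Choice of bounded_operator by <:].
HB.instance Definition _ :=
  [SubChoice_isSubLmodule of bounded_operator by <:].

Lemma bounded_operator_linear (T : bounded_operator) : linear T.
Proof. by have /bounded_operator_predP[] := bounded_operatorP T. Qed.

HB.instance Definition _ (T : bounded_operator) :=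
  GRing.isLinear.Build R[i] V W _ T (bounded_operator_linear T).

Definition opnorm (T : bounded_operator) : R :=
  sup [set rnorm (T x) | x in [set x : V | rnorm x <= 1]].

Lemma opnorm_has_sup (T : bounded_operator) :
  has_sup [set rnorm (T x) | x in [set x : V | rnorm x <= 1]].
Proof.
split.
  by exists (rnorm (T 0)), 0 => //=; rewrite /rnorm normr0 ler01.
have /bounded_operator_predP[_ [k Tk]] := bounded_operatorP T.
exists `|k| => _ [x /= x1 <-]; rewrite (le_trans (Tk x))//.
rewrite (le_trans (ler_norm _))// normrM ler_piMr// ger0_norm//.
exact: rnorm_ge0.
Qed.

Lemma opnorm_ub (T : bounded_operator) (x : V) :
  rnorm x <= 1 -> rnorm (T x) <= opnorm T.
Proof.
by move=> x1; apply: ub_le_sup; [case: (opnorm_has_sup T)|exists x].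
Qed.

Lemma opnorm_le (T : bounded_operator) (k : R) :
  (forall x, rnorm x <= 1 -> rnorm (T x) <= k) -> opnorm T <= k.
Proof.
move=> Tk; apply: ge_sup; first by case: (opnorm_has_sup T).
by move=> _ [x x1 <-]; exact: Tk.
Qed.

Lemma opnorm_ge0 (T : bounded_operator) : 0 <= opnorm T.
Proof.
apply: le_trans (opnorm_ub T (x := 0) _); first exact: rnorm_ge0.
by rewrite /rnorm normr0 ler01.
Qed.

Lemma rnorm_le_opnorm (T : bounded_operator) (x : V) :
  rnorm (T x) <= opnorm T * rnorm x.
Proof.
have [->|x0] := eqVneq x 0.
  by rewrite linear0 /rnorm !normr0 mulr0.
have xgt0 : 0 < rnorm x by rewrite -ltcR rnormE normr_gt0.
have nx : rnorm ((rnorm x)^-1%:C *: x) = 1.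
  by rewrite rnormZ ger0_norm ?lecR ?invr_ge0 ?ltW//= mulVf// gt_eqF.
have := @opnorm_ub T ((rnorm x)^-1%:C *: x).
rewrite nx lexx linearZ/= rnormZ => /(_ isT).
rewrite ger0_norm ?lecR ?invr_ge0 ?(ltW xgt0)//=.
by rewrite ler_pdivrMl// [leRHS]mulrC.
Qed.

Let opnormC (T : bounded_operator) : R[i] := (opnorm T)%:C.

Let opnormC_ler_normD S T : opnormC (S + T) <= opnormC S + opnormC T.
Proof.
rewrite /opnormC -rmorphD /= lecR; apply: opnorm_le => x x1.
by rewrite (le_trans (ler_rnormD _ _))// lerD// opnorm_ub.
Qed.

Let opnormC_normrZ (a : R[i]) T : opnormC (a *: T) = `|a| * opnormC T.
Proof.
have aR : (complex.Re `|a|)%:C = `|a| by rewrite RRe_real // realE normr_ge0.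
have leZ (b : R[i]) S : opnorm (b *: S) <= complex.Re `|b| * opnorm S.
  have b0 : 0 <= complex.Re `|b| by exact: (@rnorm_ge0 _ R[i]^o b).
  by apply: opnorm_le => x x1; rewrite rnormZ ler_wpM2l// opnorm_ub.
rewrite /opnormC -aR -rmorphM; congr (_%:C); apply/eqP.
rewrite eq_le leZ andTb.
have [->|a0] := eqVneq a 0; first by rewrite normr0 mul0r opnorm_ge0.
have an0 : 0 < complex.Re `|a| by rewrite -ltcR aR normr_gt0.
have := leZ a^-1 (a *: T); rewrite scalerA mulVf// scale1r => /(ler_wpM2l (ltW an0)).
move/le_trans; apply; rewrite mulrA -[leRHS]mul1r ler_wpM2r ?opnorm_ge0//.
have aVR : (complex.Re `|a^-1|)%:C = `|a^-1|.
  by rewrite RRe_real // realE normr_ge0.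
rewrite -lecR rmorphM.
rewrite -[leLHS]/((complex.Re `|a|)%:C * (complex.Re `|a^-1|)%:C).
by rewrite aR aVR -normrM mulfV// normr1.
Qed.

Let opnormC_eq0 T : opnormC T = 0 -> T = 0.
Proof.
move=> T0; apply: val_inj; apply/funext => x /=.
have {}T0 : opnorm T = 0 by apply: complexI; exact: T0.
have := rnorm_le_opnorm T x; rewrite T0 mul0r -lecR rnormE normr_le0.
by move/eqP.
Qed.

HB.instance Definition _ :=
  Lmodule_isNormed.Build R[i] bounded_operator
    opnormC_ler_normD opnormC_normrZ opnormC_eq0.

Lemma bounded_operator_normE (T : bounded_operator) : `|T| = (opnorm T)%:C.
Proof. by []. Qed.

End bounded_operator.

Definition dual (R : realType) (X : normedModType R[i]) :=
  bounded_operator X R[i]^o.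

Section adjoint.
Context {R : realType} {X : normedModType R[i]}.

Lemma adjoint_subproof (T : bounded_operator X X) (f : dual X) :
  f \o T \in @bounded_operator_pred R X R[i]^o.
Proof.
apply/bounded_operator_predP; split; first by move=> a x y /=; rewrite !linearP.
exists (opnorm f * opnorm T) => x /=.
rewrite (le_trans (rnorm_le_opnorm _ _))// -mulrA ler_wpM2l ?opnorm_ge0//.
exact: rnorm_le_opnorm.
Qed.

Definition adjoint (T : bounded_operator X X) (f : dual X) : dual X :=
  BoundedOperator (adjoint_subproof T f).

End adjoint.

Definition SOT (R : realType) (X : normedModType R[i]) : topologicalType :=
  initial_topology
    (fun T : bounded_operator X X => (T : X -> X) : {ptws X -> X}).

Definition SOTstar (R : realType) (X : normedModType R[i]) : topologicalType :=
  initial_topology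
    (fun T : bounded_operator X X =>
       ((T : X -> X) : {ptws X -> X},
        adjoint T : {ptws dual X -> dual X})).

Lemma initial_cvgP (S : choiceType) (T : topologicalType) (f : S -> T)
    (F : set_system S) (s : S) :
  Filter F -> (F --> (s : initial_topology f)) <-> (f @ F --> f s).
Proof.
move=> FF; split.
  by move=> Fs; apply: (cvg_comp _ _ Fs); exact: initial_continuous.
move=> fF U; rewrite nbhsE => -[_ [[B oB <-] Bs] BU].
by apply: filterS BU _; apply: fF; exact: open_nbhs_nbhs.
Qed.

Section operator_topologies_theory.
Context {R : realType} {X : normedModType R[i]}.
Local Notation BX := (bounded_operator X X).

Lemma cvg_SOTP (F : set_system (SOT X)) (T : SOT X) : Filter F ->
  (F --> T) <->
  forall x : X, `|(S : BX) x - (T : BX) x| @[S --> F] --> (0 : R[i]^o).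
Proof.
move=> FF; split.
  move/initial_cvgP/pointwise_cvgP => H x.
  by apply/norm_cvg0P/subr_cvg0; exact: H.
move=> H; apply/initial_cvgP/pointwise_cvgP => x.
by apply/subr_cvg0/norm_cvg0P; exact: H.
Qed.

Lemma cvg_SOTstarP (F : set_system (SOTstar X)) (T : SOTstar X) : Filter F ->
  (F --> T) <->
  (forall x : X, `|(S : BX) x - (T : BX) x| @[S --> F] --> (0 : R[i]^o)) /\
  (forall f : dual X, `|adjoint S f - adjoint T f| @[S --> F] --> (0 : R[i]^o)).
Proof.
move=> FF; pose ev (S : SOTstar X) : X -> X := (S : BX).
pose adj (S : SOTstar X) : dual X -> dual X := adjoint (S : BX).
split.
  move/initial_cvgP => H; split.
    have /pointwise_cvgP H1 : {ptws, ev @ F --> ev T}.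
      by apply: (@cvg_comp _ _ _ _ fst _ _ _ H); apply: cvg_fst.
    by move=> x; apply/norm_cvg0P/subr_cvg0; exact: H1.
  have /pointwise_cvgP H2 : {ptws, adj @ F --> adj T}.
    by apply: (@cvg_comp _ _ _ _ snd _ _ _ H); apply: cvg_snd.
  by move=> f; apply/norm_cvg0P/subr_cvg0; exact: H2.
move=> [H1 H2]; apply/initial_cvgP.
have K1 : {ptws, ev @ F --> ev T}.
  by apply/pointwise_cvgP => x; apply/subr_cvg0/norm_cvg0P; exact: H1.
have K2 : {ptws, adj @ F --> adj T}.
  by apply/pointwise_cvgP => x; apply/subr_cvg0/norm_cvg0P; exact: H2.
move=> U [[A B] /= [nA nB] AB].
have HA := K1 _ nA; have HB := K2 _ nB.
have HAB : F [set S | A (ev S) /\ B (adj S)].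
  by exact: (@filterI _ F FF _ _ HA HB).
apply: (@filterS _ F FF _ _ _ HAB).
by move=> S [SA SB]; apply: (AB (_, _)).
Qed.

End operator_topologies_theory.

Definition infinite_dimensional (K : fieldType) (V : lmodType K) :=
  ~ exists (n : nat) (v : 'I_n -> V),
      forall x, exists c : 'I_n -> K, x = \sum_(i < n) c i *: v i.

Section basis.
Context {R : realType} {X : normedModType R[i]}.

Definition expansion (e : nat -> X) (x : X) (a : nat -> R[i]) :=
  [series a n *: e n]_n @ \oo --> x.

Definition schauder_basis (e : nat -> X) :=
  forall x, exists! a : nat -> R[i], expansion e x a.

(* The n-th biorthogonal functional of the basis e; the default value 0 is only
   relevant when e is not a Schauder basis. *)
Definition coord (e : nat -> X) (n : nat) (x : X) : R[i] :=
  xget (fun=> 0) [set a | expansion e x a] n.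

Lemma coord_expansion (e : nat -> X) (x : X) :
  schauder_basis e -> expansion e x (coord e ^~ x).
Proof.
move=> /(_ x)[a [ea _]].
exact: (@xgetI _ (fun=> 0) [set a | expansion e x a] a ea).
Qed.

(* In R[i], 0 <= z means that z is a nonnegative real number. *)
Definition positive_vector (e : nat -> X) (x : X) :=
  forall n, 0 <= coord e n x.

Definition positive_operator (e : nat -> X) (T : X -> X) :=
  forall x, positive_vector e x -> positive_vector e (T x).

Definition positive_contractions (e : nat -> X) : set (bounded_operator X X) :=
  [set T : bounded_operator X X | positive_operator e T /\ `|T| <= 1].

Definition quasinilpotent_at (T : X -> X) (x : X) :=
  rnorm (iter n T x) `^ n%:R^-1 @[n --> \oo] --> (0 : R).

End basis.

Definition comeager (T : topologicalType) (A : set T) :=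
  exists G : set T, [/\ Gdelta G, dense G & G `<=` A].

Definition separable (T : topologicalType) :=
  exists2 D : set T, countable D & dense D.

(* Main.v *)
Require Import Defs.
From HB Require Import structures.
From mathcomp Require Import all_boot all_order all_algebra.
From mathcomp Require Import complex ring.
From mathcomp Require Import all_classical all_reals all_analysis.
From mathcomp Require Import borel_hierarchy.

Import Order.TTheory GRing.Theory Num.Theory.
Import numFieldNormedType.Exports.

Local Open Scope classical_set_scope.
Local Open Scope ring_scope.
Local Open Scope complex_scope.

(* The coordinate functionals of a Schauder basis, not the coordinates of a
   vector on a finite family. *)
Local Notation coord := Defs.coord.

(** Write e_j^* for the j-th coordinate functional.  The comeager set consists
    of the positive contractions T whose diagonal coefficients e_j^*(T e_j) are
    all nonzero.

    Such a T is not quasinilpotent at any nonzero x >= 0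
    ([not_quasinilpotent_at_positive]).  Choose j with x_j = e_j^*(x) > 0 and
    put delta = e_j^*(T e_j) > 0.  For y >= 0 the vector y - y_j e_j is
    positive, hence so is its image, which gives e_j^*(T y) >= y_j delta; by
    iteration e_j^*(T^n x) >= x_j delta^n.  As e_j^* is bounded, |T^n x| is at
    least a positive constant times delta^n, so that its n-th root stays away
    from 0.

    The set is a countable intersection of open sets because T |-> e_j^*(T e_j)
    is continuous for both topologies.  It is dense because (1 - h) T + h I is
    again a positive contraction, tends to T as h -> 0, and has diagonal
    coefficients (1 - h) e_j^*(T e_j) + h >= h > 0
    ([comeager_not_quasinilpotent]).

    Both arguments use the continuity of the coordinate functionals
    ([coord_bounded]), a theorem of Banach.  Let S_n be the partial sum
    operators and p(x) = sup_n |S_n x|.  The coordinates of x are controlled by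
    p(x), so it is enough to bound p by a multiple of the norm.  By Zabreiko's
    lemma ([zabreiko]), a consequence of the theorem of Baire, this holds as
    soon as p is countably subadditive, and that follows from the uniqueness of
    expansions ([supnorm_series]).  Zabreiko's lemma is stated for real scalars
    and applied to the real Banach space underlying X. *)

(** * The underlying real Banach space *)

(** A type of its own, so that the real and the complex structures of the same
    vectors do not compete. *)
Definition realification {R : realType} (X : normedModType R[i]) : Type := X.

Section realification.
Context {R : realType} (X : normedModType R[i]).
Local Notation Y := (realification X).

HB.instance Definition _ := GRing.Zmodule.on Y.

Let rscale (a : R) (x : Y) : Y := a%:C *: (x : X).

Fact rscaleA a b x : rscale a (rscale b x) = rscale (a * b) x.
Proof. by rewrite /rscale scalerA -rmorphM. Qed.
Fact rscale1 : left_id 1 rscale.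
Proof. by move=> x; rewrite /rscale scale1r. Qed.
Fact rscaleDr : right_distributive rscale +%R.
Proof. by move=> a x y; rewrite /rscale scalerDr. Qed.
Fact rscaleDl x : {morph rscale^~ x : a b / a + b}.
Proof. by move=> a b; rewrite /rscale rmorphD/= scalerDl. Qed.

HB.instance Definition _ :=
  GRing.Zmodule_isLmodule.Build R Y rscaleA rscale1 rscaleDr rscaleDl.

Lemma realificationZ (a : R) (x : Y) : a *: x = a%:C *: (x : X).
Proof. by []. Qed.

Fact rnorm_normrZ (a : R) (x : Y) : rnorm (a *: x : X) = `|a| * rnorm (x : X).
Proof. by rewrite realificationZ rnormZ normc_def/= expr0n addr0 sqrtr_sqr. Qed.
Fact rnorm_eq0 (x : Y) : rnorm (x : X) = 0 -> x = 0.
Proof. by move=> x0; apply/eqP; rewrite -(@normr_eq0 _ X) -rnormE x0. Qed.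

HB.instance Definition _ := Lmodule_isNormed.Build R Y
  (@ler_rnormD R X) rnorm_normrZ rnorm_eq0.

Lemma realification_normE (x : Y) : `|x| = rnorm (x : X).
Proof. by []. Qed.
End realification.

Section realification_cvg.
Context {R : realType} (X : normedModType R[i]).
Local Notation Y := (realification X).

Lemma cvg_realification T (F : set_system T) (f : T -> X) (x : X) : Filter F ->
  ((f : T -> Y) @ F --> (x : Y)) <-> (f @ F --> x).
Proof.
move=> FF; split=> /cvgrPdist_lt Fx; apply/cvgrPdist_lt => eps eps0.
  have epsE : (complex.Re eps)%:C = eps by rewrite RRe_real// realE ltW.
  have := Fx (complex.Re eps); rewrite -ltcR epsE => /(_ eps0).
  by apply: filterS => y; rewrite -ltcR epsE rnormE.
have := Fx eps%:C; rewrite ltcR => /(_ eps0).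
by apply: filterS => y; rewrite -rnormE ltcR.
Qed.

End realification_cvg.

Section realification_complete.
Context {R : realType} (X : completeNormedModType R[i]).
Local Notation Y := (realification X).

Fact realification_complete (F : set_system Y) :
  ProperFilter F -> cauchy F -> cvg F.
Proof.
move=> FF cF.
have : cauchy (F : set_system X).
  apply: (@cauchy_exP R[i] X) => eps eps0.
  have epsE : (complex.Re eps)%:C = eps by rewrite RRe_real// realE ltW.
  have [|y Fy] := (@cauchyP _ Y F FF).1 cF (complex.Re eps).
    by rewrite -ltcR epsE.
  exists y; apply: filterS Fy => z.
  rewrite -!ball_normE /ball_/= realification_normE.
  by rewrite -rnormE -[in X in _ -> X]epsE ltcR.
move/(@cauchy_cvg X F FF) => /cvg_ex[l Fl].
by apply/cvg_ex; exists l; apply/(@cvg_realification _ X _ F idfun l FF).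
Qed.

HB.instance Definition _ := Uniform_isComplete.Build Y realification_complete.

End realification_complete.

(** * Zabreiko's lemma *)

Section zabreiko.
Context {K : realType} {U : completeNormedModType K} (p : U -> K).
Hypothesis p_ge0 : forall x, 0 <= p x.
Hypothesis pD : forall x y, p (x + y) <= p x + p y.
Hypothesis pZ : forall a x, p (a *: x) = `|a| * p x.
Hypothesis p_series : forall u : U^nat, cvgn (series u) ->
  cvgn (series (p \o u)) -> p (limn (series u)) <= limn (series (p \o u)).

Let pN x : p (- x) = p x.
Proof. by rewrite -scaleN1r pZ normrN1 mul1r. Qed.

(** The sublevel sets of p at the integers cover U, so by the theorem of Baire
    the closure of one of them has interior points. *)
Lemma seminorm_sublevel_somewhere_dense :
  exists (N : nat) (a : U) (r : K), 0 < r /\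
    ball a r `<=` closure [set x | p x <= N%:R].
Proof.
pose A N := [set x | p x <= N%:R].
have [N /denseNE[W [[a [oW Wa]] WA]]] : exists N, ~ dense (~` closure (A N)).
  apply: contrapT => /forallNP dA.
  have /Baire/(_ setT) : forall N, open (~` closure (A N)) /\
      dense (~` closure (A N)).
    move=> N; split; last exact: contrapT (dA N).
    exact/closed_openC/closed_closure.
  case; [by exists 0|exact: openT|move=> x].
  case=> _ /(_ (Num.truncn (p x)).+1 I).
  apply; apply: subset_closure; rewrite /A/=.
  exact/ltW/truncnS_gt.
have /nbhs_ballP[r r0 rW] : nbhs a W by apply: open_nbhs_nbhs.
exists N, a, r; split=> // x /rW Wx; apply: contrapT => Ax.
by have : (W `&` ~` closure (A N)) x by []; rewrite WA.
Qed.

(** The sublevel sets of p are convex and symmetric, and so are their closures: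
    the ball found above can be moved to the origin. *)
Lemma seminorm_approx_ball : exists (M r : K), [/\ 0 <= M, 0 < r &
  forall x (eps : K), `|x| < r -> 0 < eps ->
    exists2 y, p y <= M & `|x - y| < eps].
Proof.
have [N [a [r [r0 arN]]]] := seminorm_sublevel_somewhere_dense.
exists N%:R, r; split=> // x eps xr eps0.
have near_sublevel z : ball a r z -> exists2 y, p y <= N%:R & `|z - y| < eps.
  move=> /arN/(_ _ (nbhsx_ballx z _ eps0))[y []].
  by rewrite -ball_normE; exists y.
have [|y yN xy] := near_sublevel (a + x).
  by rewrite -ball_normE/= opprD addNKr normrN.
have [|z zN xz] := near_sublevel (a - x).
  by rewrite -ball_normE/= opprB addrC subrK.
(* x is half the difference of a + x and a - x *)
exists (2^-1 *: (y - z)).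
  rewrite pZ ger0_norm ?invr_ge0// ler_pdivrMl//.
  by rewrite (le_trans (pD _ _))// pN mulr_natl mulr2n lerD.
have -> : x - 2^-1 *: (y - z) = 2^-1 *: ((a + x - y) - (a - x - z)).
  have -> : a + x - y - (a - x - z) = 2 *: x - (y - z).
    rewrite (addrC a x) (addrAC x a) (addrC a (- x)) (addrAC (- x) a).
    rewrite opprD addrACA subrr addr0 opprD !opprK addrACA.
    by rewrite scaler_nat mulr2n opprB (addrC z).
  by rewrite [RHS]scalerBr scalerA mulVf// scale1r.
rewrite normrZ ger0_norm ?invr_ge0// ltr_pdivrMl//.
rewrite (le_lt_trans (ler_normB _ _))// mulr_natl mulr2n ltrD//.
Qed.

(** As in the proof of the open mapping theorem: a vector of the ball is
    approximated by an element on which p is at most M, the remainder is half as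
    large and is approximated in turn, and so on.  Countable subadditivity
    bounds p on the sum of the resulting series. *)
Theorem zabreiko : exists2 C, 0 < C & forall x, p x <= C * `|x|.
Proof.
have [M [r [M0 r0 Mr]]] := seminorm_approx_ball.
have h0 : 0 < 2^-1 :> K by rewrite invr_gt0.
have step (k : nat) (x : U) : exists y, `|x| < r * 2^-1 ^+ k ->
    p y <= M * 2^-1 ^+ k /\ `|x - y| < r * 2^-1 ^+ k.+1.
  have hk : 0 < 2 ^+ k :> K by rewrite exprn_gt0.
  have hVk : 0 <= 2^-1 ^+ k :> K by rewrite exprn_ge0// ltW.
  have [xr|] := ltP `|x| (r * 2^-1 ^+ k); last first.
    by exists 0; rewrite ltNge => /negP.
  have [||y yM xy] := Mr (2 ^+ k *: x) (r / 2).
  - rewrite normrZ ger0_norm ?ltW//.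
    by rewrite mulrC -ltr_pdivlMr// -exprVn.
  - by rewrite divr_gt0.
  exists (2^-1 ^+ k *: y) => _; split.
    by rewrite pZ ger0_norm // [leLHS]mulrC ler_wpM2r.
  have -> : x - 2^-1 ^+ k *: y = 2^-1 ^+ k *: (2 ^+ k *: x - y).
    by rewrite [RHS]scalerBr scalerA -exprMn mulVf// expr1n scale1r.
  rewrite normrZ ger0_norm//.
  by rewrite exprSr mulrA mulrAC [ltRHS]mulrC ltr_pM2l// exprn_gt0.
pose g k x := sval (cid (step k x)).
have gP k x : `|x| < r * 2^-1 ^+ k ->
    p (g k x) <= M * 2^-1 ^+ k /\ `|x - g k x| < r * 2^-1 ^+ k.+1.
  by rewrite /g; case: cid.
have p_ball x0 : `|x0| < r -> p x0 <= 2 * M.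
  move=> x0r.
  (* the successive remainders; g k (x k) is the k-th approximation *)
  pose fix x n : U := if n is k.+1 then x k - g k (x k) else x0.
  have xP k : `|x k| < r * 2^-1 ^+ k.
    by elim: k => [|k /gP[]//]; rewrite mulr1.
  pose u k := g k (x k).
  have uE : series u = fun n => x0 - x n.
    apply/funext; elim=> [|n IH]; first by rewrite /series/= big_geq// subrr.
    by rewrite seriesSr IH/= opprB -addrA (addrC (- _)).
  have cu : series u @ \oo --> x0.
    rewrite uE -[X in _ --> X]subr0; apply: cvgB; first exact: cvg_cst.
    apply/norm_cvg0P.
    apply: (@squeeze_cvgr _ _ _ _ (fun=> 0) (geometric r 2^-1)).
    - by near=> n; rewrite normr_ge0/= ltW.
    - exact: cvg_cst.
    - by apply: cvg_geometric; rewrite ger0_norm ?ltW// invf_lt1// ltr1n.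
  have pu k : p (u k) <= geometric M 2^-1 k by have [] := gP k _ (xP k).
  have h1 : `|2^-1| < 1 :> K by rewrite ger0_norm ?ltW// invf_lt1// ltr1n.
  have cM := @cvg_geometric_series K M _ h1.
  have cpu : cvgn (series (p \o u)).
    apply: (@series_le_cvg _ _ (geometric M 2^-1)) => //.
    - by move=> n; exact: p_ge0.
    - by move=> n; rewrite /= mulr_ge0 // exprn_ge0 // ltW.
    - exact: cvgP cM.
  rewrite -(cvg_lim (@norm_hausdorff _ _) cu).
  apply: (le_trans (p_series _ (cvgP _ cu) cpu)).
  apply: (le_trans (lim_series_le cpu (cvgP _ cM) pu)).
  rewrite (cvg_lim (@norm_hausdorff _ _) cM).
  rewrite (_ : (1 - 2^-1)^-1 = 2 :> K) 1?mulrC //.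
  have -> : 1 - 2^-1 = 2^-1 :> K by field.
  exact: invrK.
have C0 : 0 <= 4 * M / r by rewrite divr_ge0 ?mulr_ge0// ltW.
exists (4 * M / r + 1) => [|x]; first by rewrite ltr_wpDl.
have [->|x0] := eqVneq x 0.
  by have := pZ 0 0; rewrite scale0r !normr0 mul0r mulr0 => ->.
have nx : 0 < `|x| by rewrite normr_gt0.
have c0 : 0 < r / 2 / `|x| by rewrite !divr_gt0.
have := p_ball ((r / 2 / `|x|) *: x).
rewrite normrZ pZ ger0_norm ?(ltW c0)// divfK ?gt_eqF//.
rewrite ltr_pdivrMr// mulr_natr mulr2n ltrDl r0 => /(_ isT).
rewrite -ler_pdivlMl// => /le_trans; apply.
have -> : (r / 2 / `|x|)^-1 * (2 * M) = 4 * M / r * `|x|.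
  by field; rewrite !gt_eqF.
by rewrite ler_pM2r// lerDl.
Unshelve. all: by end_near. Qed.
End zabreiko.

(** * Continuity of the coordinate functionals *)

Section coord_algebra.
Context {R : realType} {X : normedModType R[i]} {e : nat -> X}.
Hypothesis basis_e : schauder_basis e.

Lemma coord_unique (x : X) (a : nat -> R[i]) :
  expansion e x a -> coord e ^~ x = a.
Proof.
move=> xa; have [b [_ bu]] := basis_e x.
by rewrite -(bu _ xa) -(bu _ (coord_expansion basis_e)).
Qed.

Lemma coord_linear n : linear (coord e n : X -> R[i]^o).
Proof.
move=> a x y; suff : coord e ^~ (a *: x + y) =
    (fun k => a * coord e k x + coord e k y) by move/(congr1 (@^~ n)).
apply: coord_unique; rewrite /expansion.
rewrite (_ : series _ = fun m => a *: series (fun k => coord e k x *: e k) m +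
    series (fun k => coord e k y *: e k) m).
  apply: cvgD; last exact: coord_expansion.
  by apply: cvgZl_tmp; exact: coord_expansion.
apply/funext => m; rewrite /series/= scaler_sumr -big_split/=.
by apply: eq_bigr => k _; rewrite scalerDl scalerA.
Qed.

Let coord_lin n : {linear X -> R[i]^o} :=
  HB.pack (coord e n : X -> R[i]^o)
    (GRing.isLinear.Build R[i] X R[i]^o _ (coord e n) (coord_linear n)).

Lemma coordD n x y : coord e n (x + y) = coord e n x + coord e n y.
Proof. exact: (linearD (coord_lin n)). Qed.

Lemma coordB n x y : coord e n (x - y) = coord e n x - coord e n y.
Proof. exact: (linearB (coord_lin n)). Qed.

Lemma coordZ n a x : coord e n (a *: x) = a * coord e n x.
Proof. exact: (linearZ_LR (coord_lin n)). Qed.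

Lemma coord0 n : coord e n 0 = 0.
Proof. exact: (linear0 (coord_lin n)). Qed.

Lemma coord_sum n I (r : seq I) (F : I -> X) :
  coord e n (\sum_(i <- r) F i) = \sum_(i <- r) coord e n (F i).
Proof. exact: (linear_sum (coord_lin n)). Qed.

Lemma coord_basis n m : coord e n (e m) = (n == m)%:R.
Proof.
suff /(congr1 (@^~ n)) : coord e ^~ (e m) = (fun k => (k == m)%:R) by [].
apply: coord_unique; apply: cvg_near_cst; near=> k.
rewrite /series/= (bigD1_seq m) ?iota_uniq ?mem_index_iota//=; last first.
  by near: k; exact: nbhs_infty_gt.
rewrite eqxx scale1r big1 ?addr0// => j /negbTE ->.
by rewrite scale0r.
Unshelve. all: by end_near. Qed.

End coord_algebra.

Section partial_sums.
Context {R : realType} {X : completeNormedModType R[i]} {e : nat -> X}.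
Hypothesis basis_e : schauder_basis e.
Local Notation Y := (realification X).

Definition partial_sum (x : X) (n : nat) : X :=
  \sum_(0 <= k < n) coord e k x *: e k.

Lemma partial_sumD x y n :
  partial_sum (x + y) n = partial_sum x n + partial_sum y n.
Proof.
by rewrite -big_split; apply: eq_bigr => k _; rewrite coordD// scalerDl.
Qed.

Lemma partial_sumZ a x n : partial_sum (a *: x) n = a *: partial_sum x n.
Proof.
by rewrite scaler_sumr; apply: eq_bigr => k _; rewrite coordZ// scalerA.
Qed.

Lemma partial_sumB x y n :
  partial_sum (x - y) n = partial_sum x n - partial_sum y n.
Proof. by rewrite partial_sumD -scaleN1r partial_sumZ scaleN1r. Qed.

Lemma cvg_partial_sum (x : X) : (partial_sum x : nat -> Y) @ \oo --> (x : Y).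
Proof. by apply/cvg_realification; exact: coord_expansion. Qed.

(** The norm for which the partial sum operators become contractions. *)
Definition supnorm (x : Y) : R := sup [set `|partial_sum x n : Y| | n in setT].

Lemma supnorm_has_sup x : has_sup [set `|partial_sum x n : Y| | n in setT].
Proof.
split; first by exists `|partial_sum x 0 : Y|, 0%N.
have /cvg_norm/cvgP/cvg_seq_bounded/bounded_fun_has_ubound[M Mx] :=
  cvg_partial_sum x.
by exists M => _ [n _ <-]; apply: Mx; exists n.
Qed.

Lemma partial_sum_le_supnorm (x : X) n : `|partial_sum x n : Y| <= supnorm x.
Proof. by apply: ub_le_sup; [case: (supnorm_has_sup x)|exists n]. Qed.

Lemma supnorm_le (x : X) M :
  (forall n, `|partial_sum x n : Y| <= M) -> supnorm x <= M.
Proof.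
move=> xM; apply: ge_sup; first by case: (supnorm_has_sup x).
by move=> _ [n _ <-].
Qed.

Lemma norm_le_supnorm (x : Y) : `|x| <= supnorm x.
Proof.
have cx : `|partial_sum x n : Y| @[n --> \oo] --> `|x|.
  exact: cvg_norm (cvg_partial_sum x).
rewrite -(cvg_lim (@norm_hausdorff _ _) cx).
apply: limr_le; first exact: cvgP cx.
by apply: nearW => n; exact: partial_sum_le_supnorm.
Qed.

Lemma supnorm_ge0 x : 0 <= supnorm x.
Proof. exact: le_trans (normr_ge0 _) (norm_le_supnorm x). Qed.

Lemma supnormD x y : supnorm (x + y) <= supnorm x + supnorm y.
Proof.
apply: supnorm_le => n; rewrite partial_sumD (le_trans (@ler_normD _ Y _ _))//.
by rewrite lerD// partial_sum_le_supnorm.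
Qed.

Lemma supnorm_sum I (r : seq I) (F : I -> Y) :
  supnorm (\sum_(i <- r) F i) <= \sum_(i <- r) supnorm (F i).
Proof.
elim: r => [|i r IH].
  rewrite !big_nil; apply: supnorm_le => n.
  by rewrite /partial_sum big1 ?normr0// => k _; rewrite coord0// scale0r.
by rewrite !big_cons (le_trans (supnormD _ _))// lerD2l.
Qed.

Lemma supnormZ (a : R) x : supnorm (a *: x) = `|a| * supnorm x.
Proof.
have leZ b y : supnorm (b *: y) <= `|b| * supnorm y.
  apply: supnorm_le => n; rewrite partial_sumZ (@normrZ _ Y b).
  by rewrite ler_wpM2l// partial_sum_le_supnorm.
have [->|a0] := eqVneq a 0.
  apply/eqP; rewrite eq_le leZ/= normr0 mul0r; exact: supnorm_ge0.
apply/eqP; rewrite eq_le leZ/=.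
rewrite -ler_pdivlMl ?normr_gt0// -normfV (le_trans _ (leZ _ _))//.
by rewrite scalerA mulVf// scale1r.
Qed.

Lemma basis_neq0 k : e k != 0.
Proof.
apply/eqP => ek0; have := coord_basis basis_e k k.
by rewrite ek0 coord0// eqxx => /eqP; rewrite eq_sym oner_eq0.
Qed.

Lemma norm_basis_gt0 k : 0 < `|e k : Y|.
Proof. by rewrite normr_gt0; exact: basis_neq0. Qed.

Lemma coord_le_supnorm k (x : X) :
  complex.Re `|coord e k x| * `|e k : Y| <= 2 * supnorm x.
Proof.
rewrite -rnormZ -realification_normE.
have -> : coord e k x *: e k = partial_sum x k.+1 - partial_sum x k.
  by rewrite /partial_sum big_nat_recr//= [RHS]addrC addKr.
rewrite (le_trans (@ler_normB _ Y _ _))// mulr_natl mulr2n.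
by rewrite lerD// partial_sum_le_supnorm.
Qed.

(** Reduces the convergence of complex multiples of a vector to that of the real
    and imaginary parts of the coefficients, where completeness of the reals
    applies. *)
Lemma complex_scaleE (c : R[i]) (v : X) :
  c *: v = (complex.Re c *: (v : Y)) + (complex.Im c *: ('i *: v : Y)).
Proof.
rewrite -[RHS]/((complex.Re c)%:C *: v + (complex.Im c)%:C *: ('i *: v)).
rewrite scalerA -scalerDl; congr (_ *: _).
by rewrite {1}[c]complexE mulrC.
Qed.

Lemma normRe_le (c : R[i]) : `|complex.Re c| <= complex.Re `|c|.
Proof.
by case: c => a b; rewrite normc_def/= -sqrtr_sqr ler_wsqrtr// lerDl sqr_ge0.
Qed.

Lemma normIm_le (c : R[i]) : `|complex.Im c| <= complex.Re `|c|.
Proof.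
by case: c => a b; rewrite normc_def/= -sqrtr_sqr ler_wsqrtr// lerDr sqr_ge0.
Qed.

End partial_sums.

Section supnorm_series.
Context {R : realType} {X : completeNormedModType R[i]} {e : nat -> X}.
Hypothesis basis_e : schauder_basis e.
Local Notation Y := (realification X).
Local Notation supnorm := (@supnorm R X e).
Local Notation partial_sum := (@partial_sum R X e).

(** Each coordinate is bounded by a multiple of supnorm, so the coordinates of
    the terms form an absolutely convergent series. *)
Lemma cvg_coord_series (u : Y ^nat) k : cvgn (series (supnorm \o u)) ->
  exists z : R[i],
    (coord e k (series u m) *: e k : Y) @[m --> \oo] --> (z *: e k : Y).
Proof.
move=> cu.
have part_cvg (f : R[i] -> R) : (forall c, `|f c| <= complex.Re `|c|) ->
    cvgn (series (fun j => f (coord e k (u j)))).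
  move=> fle; apply: (@normed_cvg _ R^o).
  apply: (@series_le_cvg _ _ (2 / `|e k : Y| *: (supnorm \o u))).
  - by move=> j; exact: normr_ge0.
  - move=> j; rewrite /= mulr_ge0 ?divr_ge0//; exact: supnorm_ge0.
  - move=> j; rewrite -[leRHS]/(2 / `|e k : Y| * supnorm (u j)).
    rewrite mulrAC ler_pdivlMr ?norm_basis_gt0//.
    apply: le_trans (coord_le_supnorm basis_e k (u j)).
    by apply: ler_wpM2r; [exact: normr_ge0|exact: fle].
  - exact: is_cvg_seriesZ.
have [A cA] := (cvg_ex _).1 (part_cvg _ (@normRe_le R)).
have [B cB] := (cvg_ex _).1 (part_cvg _ (@normIm_le R)).
exists (A +i* B); rewrite complex_scaleE.
under eq_fun do rewrite complex_scaleE.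
have coordE m : coord e k (series u m) = \sum_(0 <= j < m) coord e k (u j).
  exact: coord_sum.
apply: cvgD; apply: cvgZr_tmp; under eq_fun do rewrite coordE raddf_sum.
  exact: cA.
exact: cB.
Qed.

(** Let x be the sum of the u_j and s_n the sum of the z_k e_k for k < n, where
    z_k is the sum of the k-th coordinates of the u_j.  The n-th partial sums of
    u_0 + ... + u_(l-1) are at distance at most the tail of the series of the
    supnorm u_j from s_n, uniformly in n.  Hence s_n tends to x, the z_k are the
    coordinates of x by uniqueness, and l = 0 gives the bound. *)
Lemma supnorm_series (u : Y ^nat) : cvgn (series u) ->
  cvgn (series (supnorm \o u)) ->
  supnorm (limn (series u)) <= limn (series (supnorm \o u)).
Proof.
move=> cu cpu; set x := limn (series u); set M := limn _.
have ndpu : nondecreasing_seq (series (supnorm \o u)).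
  by apply: nondecreasing_series => j _ _; exact: supnorm_ge0.
have /choice[z zP] := fun k => cvg_coord_series u k cpu.
pose s n : Y := \sum_(0 <= k < n) z k *: e k.
have cs n : (partial_sum (series u m) n : Y) @[m --> \oo] --> s n.
  rewrite /s /partial_sum; elim: n => [|n IH].
    under eq_fun do rewrite big_geq//; rewrite big_geq//; exact: cvg_cst.
  under eq_fun do rewrite big_nat_recr//=; rewrite big_nat_recr//=.
  by apply: (@cvgD _ Y).
have s_tail l n :
    `|s n - partial_sum (series u l) n : Y| <= M - series (supnorm \o u) l.
  pose diff m : Y := partial_sum (series u m) n - partial_sum (series u l) n.
  have c1 : diff @ \oo --> (s n - partial_sum (series u l) n : Y).
    by apply: (@cvgB _ Y) => //; exact: cvg_cst.
  have {}c1 : `|diff m| @[m --> \oo]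
      --> `|s n - partial_sum (series u l) n : Y| by exact: cvg_norm c1.
  rewrite -(cvg_lim (@norm_hausdorff _ _) c1).
  apply: limr_le; first exact: cvgP c1.
  near=> m; have lm : (l <= m)%N by near: m; exact: nbhs_infty_ge.
  rewrite /diff -partial_sumB//.
  rewrite (le_trans (partial_sum_le_supnorm basis_e _ _))//.
  rewrite (_ : _ - _ = \sum_(l <= j < m) u j); last exact: sub_series_geq.
  rewrite (le_trans (supnorm_sum basis_e _ _ _))//.
  rewrite -[leLHS](sub_series_geq (supnorm \o u) lm) lerD2r.
  exact: nondecreasing_cvgn_le.
have xs : s @ \oo --> x.
  apply/cvgrPdist_lt => eps eps0.
  have eps3 : 0 < eps / 3 by rewrite divr_gt0.
  have [l [lM lx]] : exists l, M - series (supnorm \o u) l < eps / 3 /\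
      `|x - series u l| < eps / 3.
    have /cvgrPdist_lt/(_ _ eps3) H1 : series (supnorm \o u) @ \oo --> M by [].
    have /cvgrPdist_lt/(_ _ eps3) H2 : series u @ \oo --> x by [].
    have [l [H3 H4]] := filter_ex (filterI H1 H2).
    by exists l; split=> //; apply: le_lt_trans H3; exact: ler_norm.
  have /cvgrPdist_lt/(_ _ eps3) := cvg_partial_sum basis_e (series u l).
  apply: filterS => n nl.
  have -> : x - s n = (x - series u l)
      + (series u l - partial_sum (series u l) n : Y)
      + (partial_sum (series u l) n - s n : Y).
    by rewrite -(addrA (x - _)) subrKA subrKA.
  rewrite (le_lt_trans (ler_normD _ _))//.
  have -> : eps = eps / 3 + eps / 3 + eps / 3 by field.
  rewrite ltrD//; last by rewrite distrC; exact: le_lt_trans (s_tail l n) _.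
  by rewrite (le_lt_trans (ler_normD _ _))// ltrD.
have xz : expansion e x z by apply/cvg_realification.
have sp n : partial_sum x n = s n.
  apply: eq_bigr => k _.
  by rewrite -[coord e k x]/((coord e ^~ x) k) (coord_unique basis_e x z xz).
apply: supnorm_le => // n; rewrite sp.
have := s_tail 0%N n.
rewrite /series/= !big_geq// subr0.
rewrite (_ : partial_sum 0 n = 0) ?subr0//.
by rewrite /partial_sum big1// => k _; rewrite coord0// scale0r.
Unshelve. all: by end_near. Qed.

(** Banach's theorem on the continuity of the coordinate functionals: they are
    controlled by supnorm, which Zabreiko's lemma compares with the norm. *)
Theorem coord_bounded k :
  exists2 C, 0 < C & forall x : X, complex.Re `|coord e k x| <= C * rnorm x.
Proof.
have [C C0 xC] := zabreiko supnorm (supnorm_ge0 basis_e) (supnormD basis_e)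
  (supnormZ basis_e) supnorm_series.
have ek := norm_basis_gt0 basis_e k.
exists (2 * C / `|e k : Y|) => [|x]; first by rewrite divr_gt0 ?mulr_gt0.
rewrite mulrAC ler_pdivlMr//.
rewrite (le_trans (coord_le_supnorm basis_e k x))// -mulrA ler_wpM2l//.
Qed.

Corollary coord_continuous k : continuous (coord e k : X -> R[i]^o).
Proof.
have [C C0 kC] := coord_bounded k.
move=> x; apply/cvgrPdist_lt => eps eps0.
have epsE : (complex.Re eps)%:C = eps by rewrite RRe_real// realE ltW.
have eps'0 : 0 < complex.Re eps by rewrite -ltcR epsE.
have /cvgrPdist_lt/(_ (complex.Re eps / C)%:C) := @cvg_id X (nbhs x).
rewrite ltcR divr_gt0// => /(_ isT); apply: filterS => y.
rewrite -rnormE ltcR ltr_pdivlMr// mulrC => xy.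
rewrite -coordB// -(@rnormE _ R[i]^o) -epsE ltcR.
exact: le_lt_trans (kC _) xy.
Qed.

End supnorm_series.

(** * Orbits of positive vectors *)

Section positive_operator_orbits.
Context {R : realType} {X : completeNormedModType R[i]} {e : nat -> X}.
Hypothesis basis_e : schauder_basis e.

Lemma positive_orbit (T : X -> X) x n : positive_operator e T ->
  positive_vector e x -> positive_vector e (iter n T x).
Proof. by move=> Tpos x_ge0; elim: n => //= n IH; exact: Tpos. Qed.

(** The vector y - y_j e_j is positive, and so is its image under T. *)
Lemma coord_image_ge (T : bounded_operator X X) j y : positive_operator e T ->
  positive_vector e y ->
  coord e j y * coord e j (T (e j)) <= coord e j (T y).
Proof.
move=> Tpos y_ge0.
have /Tpos/(_ j) : positive_vector e (y - coord e j y *: e j).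
  move=> i; rewrite coordB// coordZ// coord_basis//.
  by have [->|ij] := eqVneq i j; rewrite ?mulr1 ?subrr// mulr0 subr0.
by rewrite linearB linearZ/= coordB// coordZ// subr_ge0.
Qed.

Lemma coord_orbit_ge (T : bounded_operator X X) j x n : positive_operator e T ->
  positive_vector e x -> 0 <= coord e j (T (e j)) ->
  coord e j x * coord e j (T (e j)) ^+ n <= coord e j (iter n T x).
Proof.
move=> Tpos x_ge0 Tj; elim: n => [|n IH]; first by rewrite expr0 mulr1.
rewrite exprSr mulrA; apply: le_trans (coord_image_ge _ _ _ Tpos _).
  by rewrite ler_wpM2r.
exact: positive_orbit.
Qed.

Lemma positive_basis j : positive_vector e (e j).
Proof. by move=> i; rewrite coord_basis// ler0n. Qed.

(** The diagonal coefficient at an index where x has a nonzero coordinate gives a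
    geometric lower bound for the norms along the orbit of x. *)
Lemma not_quasinilpotent_at_positive (T : bounded_operator X X) x :
  positive_operator e T -> (forall j, coord e j (T (e j)) != 0) ->
  x != 0 -> positive_vector e x -> ~ quasinilpotent_at T x.
Proof.
move=> Tpos Tdiag x0 x_ge0 quasiT.
have [j xj0] : exists j, coord e j x != 0.
  apply: contrapT => /forallNP xj; move/eqP: x0; apply.
  have := coord_expansion (x := x) basis_e; rewrite /expansion.
  have -> : series (fun n => coord e n x *: e n) = fun=> 0.
    apply/funext => n; rewrite /series/= big1// => k _.
    by move/negP: (xj k); rewrite negbK => /eqP ->; rewrite scale0r.
  by move/(cvg_lim (@norm_hausdorff _ _)) => <-; exact: lim_cst.
have toRE z : 0 <= z -> (complex.Re z)%:C = z.
  by move=> z0; rewrite RRe_real// realE z0.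
set del := coord e j (T (e j)).
have del0 : 0 <= del by apply: Tpos; exact: positive_basis.
have d_gt0 : 0 < complex.Re del by rewrite -ltcR toRE// lt_def Tdiag.
have c_gt0 : 0 < complex.Re (coord e j x).
  by rewrite -ltcR toRE// lt_def xj0 x_ge0.
have [C C0 coordC] := coord_bounded basis_e j.
(* b <= 1 gives b ^ n <= b, so that b can be moved under the n-th root *)
pose b := Num.min (complex.Re (coord e j x) / C) 1.
have b_gt0 : 0 < b by rewrite /b lt_min ltr01 divr_gt0.
have orbit_ge n : complex.Re (coord e j x) / C * complex.Re del ^+ n
    <= rnorm (iter n T x).
  rewrite mulrAC ler_pdivrMr// [leRHS]mulrC (le_trans _ (coordC _))//.
  have itpos := positive_orbit _ _ n Tpos x_ge0.
  rewrite ger0_norm// -lecR rmorphM rmorphXn/=.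
  rewrite -[leLHS]/(_%:C * _%:C ^+ n) !toRE//; exact: coord_orbit_ge.
have root_ge n : b * complex.Re del <= rnorm (iter n.+1 T x) `^ n.+1%:R^-1.
  have bd0 : 0 <= b * complex.Re del by rewrite mulr_ge0 ?ltW.
  have -> : b * complex.Re del = ((b * complex.Re del) ^+ n.+1) `^ n.+1%:R^-1.
    by rewrite -powR_mulrn// -powRrM mulfV ?pnatr_eq0// powRr1.
  apply: ge0_ler_powR; rewrite ?invr_ge0 ?nnegrE ?exprn_ge0 ?rnorm_ge0//.
  apply: le_trans (orbit_ge n.+1); rewrite exprMn.
  apply: ler_wpM2r; first by rewrite exprn_ge0// ltW.
  apply: (@le_trans _ _ b); last by rewrite /b ge_min lexx.
  rewrite exprS; apply: ler_piMr; first exact: ltW.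
  by rewrite exprn_ile1 ?(ltW b_gt0)// /b ge_min lexx orbT.
have : b * complex.Re del <= 0.
  rewrite -(cvg_lim (@norm_hausdorff _ _) quasiT).
  apply: limr_ge; first exact: cvgP quasiT.
  near=> n; have n0 : (0 < n)%N by near: n; exact: nbhs_infty_gt.
  by rewrite -(prednK n0); exact: root_ge.
by rewrite leNgt mulr_gt0.
Unshelve. all: by end_near. Qed.

(** The topology of S matters only through the continuity of the evaluations and
    the convergence of the perturbations (1 - h) f(s) + h I to f(s), which lets
    the same argument serve several operator topologies. *)
Lemma comeager_not_quasinilpotent (S : topologicalType)
    (f : S -> bounded_operator X X) :
  (forall s, positive_operator e (f s)) ->
  (forall x, continuous (fun s => f s x)) ->
  (forall s, exists2 t : nat -> S, t @ \oo --> s & forall n x,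
     f (t n) x = (1 - harmonic n)%:C *: f s x + (harmonic n)%:C *: x) ->
  comeager [set s | forall x, x != 0 -> positive_vector e x ->
    ~ quasinilpotent_at (f s) x].
Proof.
move=> f_pos f_cont f_mix.
exists [set s | forall j, coord e j (f s (e j)) != 0]; split.
- exists (fun j => [set s | coord e j (f s (e j)) != 0]).
    move=> j; rewrite (_ : [set s | _] =
      (fun s => coord e j (f s (e j)) : R[i]^o) @^-1` [set~ 0]); last first.
      by apply/seteqP; split=> s /= /eqP.
    apply: open_comp.
      move=> s _; apply: (@continuous_comp _ _ _ (fun s => f s (e j))
        (coord e j : X -> R[i]^o)).
        exact: f_cont.
      exact: coord_continuous.
    apply: closed_openC; apply: accessible_closed_set1.
    by apply: hausdorff_accessible; exact: norm_hausdorff.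
  by apply/seteqP; split=> [s sG j _|s sG j]; [exact: sG|exact: (sG j I)].
- move=> O [s Os] oO; have [t ts ft] := f_mix s.
  have : \forall n \near \oo, O (t n) by apply: ts; exact: open_nbhs_nbhs.
  case=> n _ /(_ n (leqnn n)) /= Otn; exists (t n); split=> // j.
  have h0 : 0 < (@harmonic R n)%:C by rewrite ltcR harmonic_gt0.
  have h1 : 0 <= (1 - @harmonic R n)%:C.
    by rewrite lecR subr_ge0 /= invf_le1// ler1n.
  rewrite ft coordD// !coordZ// coord_basis// eqxx mulr1 gt_eqF//.
  rewrite ltr_wpDl// mulr_ge0//; apply: f_pos; exact: positive_basis.
- by move=> s sG x x0 xpos; exact: not_quasinilpotent_at_positive.
Qed.

End positive_operator_orbits.

(** * Perturbation by the identity *)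

Section mix.
Context {R : realType} {X : normedModType R[i]}.

Lemma id_bounded_operator : idfun \in @bounded_operator_pred R X X.
Proof.
apply/bounded_operator_predP; split=> //.
by exists 1 => x; rewrite mul1r.
Qed.

Definition id_operator : bounded_operator X X :=
  BoundedOperator id_bounded_operator.

Lemma opnorm_id : opnorm id_operator <= 1.
Proof. exact: opnorm_le. Qed.

Definition mix_id (h : R) (T : bounded_operator X X) : bounded_operator X X :=
  (1 - h)%:C *: T + h%:C *: id_operator.

Lemma mix_idE h T x : mix_id h T x = (1 - h)%:C *: T x + h%:C *: x.
Proof. by []. Qed.

Lemma mix_id_sub (h : R) T x : mix_id h T x - T x = h%:C *: (x - T x).
Proof.
rewrite mix_idE rmorphB/= scalerBl scale1r scalerBr.
by rewrite addrAC (addrAC (T x)) subrr sub0r addrC.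
Qed.

Lemma mix_id_positive_contraction e (h : R) T :
  schauder_basis e -> 0 <= h <= 1 ->
  positive_contractions e T -> positive_contractions e (mix_id h T).
Proof.
move=> basis_e /andP[h0 h1] [Tpos T1].
have h'0 : 0 <= 1 - h by rewrite subr_ge0.
split=> [x x_ge0 n|].
  rewrite mix_idE coordD// !coordZ// addr_ge0// mulr_ge0 ?lecR//.
  exact: Tpos.
rewrite (le_trans (ler_normD _ _))// !normrZ !ger0_norm ?lecR//.
apply: (@le_trans _ _ ((1 - h)%:C * 1 + h%:C * 1)).
  apply: lerD; apply: ler_wpM2l; rewrite ?lecR//; last exact: opnorm_id.
  by rewrite -lecR.
by rewrite !mulr1 -rmorphD subrK.
Qed.

Lemma adjoint_mix_id_sub (h : R) T (g : dual X) :
  adjoint (mix_id h T) g - adjoint T g = h%:C *: (g - adjoint T g).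
Proof.
apply: val_inj; apply/funext => x.
rewrite -[LHS]/(g (mix_id h T x) - g (T x)) -[RHS]/(h%:C *: (g x - g (T x))).
by rewrite -linearB mix_id_sub linearZ/= linearB.
Qed.

Lemma cvg_harmonic_scale (V : normedModType R[i]) (v : V) :
  `|(@harmonic R n)%:C *: v| @[n --> \oo] --> (0 : R[i]^o).
Proof.
have h0 : @harmonic R n @[n --> \oo] --> 0 := cvg_harmonic.
have : (@harmonic R n *: (v : realification V)) @[n --> \oo] -->
    (0 : realification V).
  rewrite -(scale0r (v : realification V)); exact: cvgZr_tmp.
by move/(cvg_realification V) => H; apply/norm_cvg0P.
Qed.

Lemma SOT_mix_cvg (T : SOT X) :
  ((fun n => mix_id (harmonic n) (T : bounded_operator X X)) : nat -> SOT X)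
    @ \oo --> T.
Proof.
apply/cvg_SOTP => x.
have := cvg_harmonic_scale X (x - (T : bounded_operator X X) x).
by under eq_fun do rewrite -mix_id_sub.
Qed.

Lemma SOTstar_mix_cvg (T : SOTstar X) :
  ((fun n => mix_id (harmonic n) (T : bounded_operator X X)) : nat -> SOTstar X)
    @ \oo --> T.
Proof.
apply/cvg_SOTstarP; split=> [x|g].
  have := cvg_harmonic_scale X (x - (T : bounded_operator X X) x).
  by under eq_fun do rewrite -mix_id_sub.
have := cvg_harmonic_scale (dual X) (g - adjoint T g).
by under eq_fun do rewrite -adjoint_mix_id_sub.
Qed.

Lemma SOT_eval_continuous x :
  continuous (fun T : SOT X => (T : bounded_operator X X) x).
Proof.
move=> T; have /cvg_SOTP/(_ x) := @cvg_id _ (nbhs T).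
by move/norm_cvg0P/subr_cvg0.
Qed.

Lemma SOTstar_eval_continuous x :
  continuous (fun T : SOTstar X => (T : bounded_operator X X) x).
Proof.
move=> T; have /cvg_SOTstarP[/(_ x)] := @cvg_id _ (nbhs T).
by move/norm_cvg0P/subr_cvg0.
Qed.

End mix.

(** * Typical positive contractions *)

Section typical.
Context {R : realType} {X : completeNormedModType R[i]} {e : nat -> X}.
Hypothesis basis_e : schauder_basis e.

(** The points of tau stand for operators through op, which has the section
    of_op.  For both operator topologies these maps are the identity of the
    bounded operators, so the lemma covers the two cases at once. *)
Lemma typical_positive_contraction (tau : topologicalType)
    (op : tau -> bounded_operator X X) (of_op : bounded_operator X X -> tau) :
  cancel of_op op ->
  (forall x, continuous (fun s => op s x)) ->
  (forall s, (fun n => of_op (mix_id (harmonic n) (op s))) @ \oo --> s) ->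
  comeager [set s : (op @^-1` positive_contractions e) |
    forall x, x != 0 -> positive_vector e x ->
      ~ quasinilpotent_at (op (set_val s)) x].
Proof.
move=> opK op_cont mix_cvg.
apply: (comeager_not_quasinilpotent basis_e _ (op \o set_val)).
- by move=> s; have [] := set_valP s.
- move=> x s; apply: (@continuous_comp _ _ _ set_val (fun T => op T x) s).
    exact: initial_continuous.
  exact: op_cont.
- move=> s.
  have mixP n : (op @^-1` positive_contractions e)
      (of_op (mix_id (harmonic n) (op (set_val s)))).
    rewrite /= opK; apply: mix_id_positive_contraction (set_valP s) => //.
    by rewrite harmonic_ge0/= invf_le1// ler1n.
  exists (fun n => exist (fun s => s \in op @^-1` positive_contractions e) _
    (mem_set (mixP n))).
    by apply/initial_cvgP; exact: mix_cvg.
  by move=> n x; rewrite /= opK.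
Qed.

End typical.

Theorem corollary1p9 (R : realType) (X : completeNormedModType R[i])
    (e : nat -> X)
    (infX : infinite_dimensional X) (basis_e : schauder_basis e) :
  comeager [set T : (positive_contractions e : set (SOT X)) |
    forall x : X, x != 0 -> positive_vector e x ->
      ~ quasinilpotent_at (set_val T : bounded_operator X X) x]
  /\
  (separable (dual X) ->
   comeager [set T : (positive_contractions e : set (SOTstar X)) |
     forall x : X, x != 0 -> positive_vector e x ->
       ~ quasinilpotent_at (set_val T : bounded_operator X X) x]).
Proof.
split=> [|_].
  apply: (typical_positive_contraction basis_e (SOT X) idfun idfun) => //.
  - exact: SOT_eval_continuous.
  - exact: SOT_mix_cvg.
apply: (typical_positive_contraction basis_e (SOTstar X) idfun idfun) => //.
- exact: SOTstar_eval_continuous.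
- exact: SOTstar_mix_cvg.
Qed.
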